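(* Let $H$ be a Hilbert space, let $F:H\to(-\infty,+\infty]$ be proper and lower semicontinuous, let $\widetilde F:H\to(-\infty,+\infty]$, and set $X^\star:=\operatorname{argmin}_H F$. Let $R,M>0$ and $\delta\ge 0$, and assume that $$\mathcal G_{R,M}(F,\widetilde F)\le \delta,$$ and that $F$ satisfies the set-based quadratic growth condition on $B(0,R)$ with parameter $\mu>0$, namely $$F(x)-\inf_H F \ge \frac{\mu}{2}\,\mathrm{dist}(x,X^\star)^2\qquad \text{for all } x\in H \text{ with } \|x\|\le R.$$ Let $$x^\star\in X^\star\cap B(0,R),\qquad \widetilde x^\star\in \operatorname{argmin}_{\|x\|\le R}\widetilde F,$$ and assume in addition that $$F(x^\star),\ \widetilde F(x^\star),\ F(\widetilde x^\star),\ \widetilde F(\widetilde x^\star)\in[-M,M].$$ Then $$\mathrm{dist}(\widetilde x^\star,X^\star)\le 2\sqrt{\frac{\delta}{\mu}}.$$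
   Context: $B(0,R)=\{x\in H:\|x\|\le R\}$. For nonempty $S\subset H$, $\mathrm{dist}(x,S):=\inf_{y\in S}\|x-y\|$. $\operatorname{argmin}_{\|x\|\le R}\widetilde F$ is the set of minimizers of $\widetilde F$ over the ball $B(0,R)$. For a functional $F:H\to(-\infty,+\infty]$, the vertical distance-to-epigraph map is, for $(x,t)\in H\times\mathbb{R}$, $$d_F^{\mathrm v}(x,t):=\inf_{s\in\mathbb{R},\,s\ge F(x)}|t-s|=(F(x)-t)_+\in[0,+\infty],\qquad (r)_+:=\max\{r,0\}.$$ For $R,M>0$ let $C_{R,M}:=\{(x,t)\in H\times\mathbb{R}:\ \|x\|\le R,\ |t|\le M\}$. The localized vertical epigraphic gauge is $$\mathcal G_{R,M}(F,\widetilde F):=\sup_{(x,t)\in C_{R,M}}\bigl|d_F^{\mathrm v}(x,t)-d_{\widetilde F}^{\mathrm v}(x,t)\bigr|\in[0,+\infty],$$ with the convention that the difference is $0$ where both distances equal $+\infty$ (and its absolute value is $+\infty$ where exactly one of them does). *)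

(* Defs.v *)
From HB Require Import structures.
From mathcomp Require Import all_boot all_order all_algebra.
From mathcomp Require Import all_classical all_reals all_analysis.

Set Implicit Arguments.
Unset Strict Implicit.
Unset Printing Implicit Defensive.

Import Order.TTheory GRing.Theory Num.Theory.
Import numFieldNormedType.Exports.

Local Open Scope classical_set_scope.
Local Open Scope ring_scope.

(* A real Hilbert space is a complete normed module whose norm is induced by
   an inner product.  A complex Hilbert space is covered through its underlying
   real structure, with the real part of its inner product. *)
Definition norm_induced_by (R : realType) (H : completeNormedModType R)
    (ip : {dot H for idfun}) : Prop :=
  forall x : H, ip x x = `|x| ^+ 2.

Definition origin_ball (R : realType) (H : completeNormedModType R) (r : R)
  : set H := [set x | `|x| <= r].

(* Infimum in R, so it is meaningful for nonempty S only (inf set0 = 0). *)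
Definition dist (R : realType) (H : completeNormedModType R) (x : H)
    (S : set H) : R :=
  inf [set `|x - y| | y in S].

Definition argmin (R : realType) (T : Type) (A : set T) (f : T -> \bar R)
  : set T := [set x | A x /\ forall y, A y -> (f x <= f y)%E].

Definition proper_functional (R : realType) (T : Type) (f : T -> \bar R) : Prop :=
  (forall x, f x != -oo%E) /\ (exists x, (f x < +oo)%E).

Definition quadratic_growth (R : realType) (H : completeNormedModType R)
    (F : H -> \bar R) (A : set H) (mu : R) : Prop :=
  forall x, A x ->
    ((mu / 2 * dist x (argmin setT F) ^+ 2)%:E
       <= F x - ereal_inf (range F))%E.

(* The infimum of the empty set being +oo, the value is +oo iff F x = +oo. *)
Definition vdist (R : realType) (T : Type) (F : T -> \bar R) (x : T) (t : R)
  : \bar R :=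
  ereal_inf [set `|t - s|%:E | s in [set s : R | (F x <= s%:E)%E]].

(* Absolute difference on [0, +oo].  The case split is needed because
   `|+oo - +oo| evaluates to +oo; when exactly one argument is +oo,
   `|a - b| is +oo as intended. *)
Definition absdiff (R : realType) (a b : \bar R) : \bar R :=
  if (a == +oo%E) && (b == +oo%E) then 0%E else `|a - b|%E.

Definition cylinder (R : realType) (H : completeNormedModType R) (r M : R)
  : set (H * R) := [set p | `|p.1| <= r /\ `|p.2| <= M].

Definition epi_gauge (R : realType) (H : completeNormedModType R) (r M : R)
    (F G : H -> \bar R) : \bar R :=
  ereal_sup [set absdiff (vdist F p.1 p.2) (vdist G p.1 p.2)
            | p in cylinder r M].

(* Main.v *)
Require Import Defs.
From HB Require Import structures.
From mathcomp Require Import all_boot all_order all_algebra.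
From mathcomp Require Import all_classical all_reals all_analysis.
From mathcomp Require Import ring lra.
Import Order.TTheory GRing.Theory Num.Theory.
Import numFieldNormedType.Exports.
Local Open Scope classical_set_scope.
Local Open Scope ring_scope.

(** Taking the lowest level t = - M of the cylinder makes the gauge see the
    values of the functionals themselves: if x lies in the ball and F x and
    Ft x are real and at least - M, then the vertical distances from (x, - M)
    to the two epigraphs are F x + M and Ft x + M, and their difference is
    F x - Ft x.  Hence the gauge bound gives |F x - Ft x| <= delta at such
    points ([epi_gauge_value_close]), in particular at xs and xt.

    The usual comparison of the values of a function and its perturbation
    then gives
      F xt <= Ft xt + delta <= Ft xs + delta <= F xs + 2 delta,
    the middle step because xt minimizes Ft on a ball which contains xs.
    Since F xs is the infimum of F, quadratic growth at xt yields
    mu / 2 * dist^2 <= 2 delta, which is the claim after a square root. *)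

Lemma vdist_below {R : realType} {T : Type} {F : T -> \bar R} {x : T}
    {a t : R} :
  F x = a%:E -> t <= a -> vdist F x t = (a - t)%:E.
Proof.
move=> Fxa ta; apply/le_anti/andP; split.
  apply: ereal_inf_lbound; exists a; first by rewrite /= Fxa.
  by rewrite distrC ger0_norm // subr_ge0.
apply: le_ereal_inf_tmp => _ [s /= + <-]; rewrite Fxa !lee_fin => les.
by rewrite distrC (le_trans _ (ler_norm _)) // lerD2r.
Qed.

(** At height - M both vertical distances are finite and equal the values
    shifted by M, so the gauge controls the gap between the values. *)
Lemma epi_gauge_value_close {R : realType} {H : completeNormedModType R}
    {F G : H -> \bar R} {r M delta a b : R} {x : H} :
  0 <= M -> (epi_gauge r M F G <= delta%:E)%E -> `|x| <= r ->
  F x = a%:E -> G x = b%:E -> - M <= a -> - M <= b -> `|a - b| <= delta.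
Proof.
move=> M0 gauge xr Fxa Gxb Ma Mb; rewrite -lee_fin; apply: le_trans gauge.
apply: ereal_sup_ubound; exists (x, - M) => /=.
  by split => //=; rewrite normrN ger0_norm.
rewrite (vdist_below Fxa Ma) (vdist_below Gxb Mb) /absdiff /=.
by congr (`| _ |%:E); ring.
Qed.

Lemma ereal_inf_range_argmin {R : realType} {T : Type} {F : T -> \bar R}
    {x : T} :
  argmin setT F x -> ereal_inf (range F) = F x.
Proof.
move=> [_ Fmin]; apply/le_anti/andP; split.
  by apply: ereal_inf_lbound; exists x.
by apply: le_ereal_inf_tmp => _ [y _ <-]; exact: Fmin.
Qed.

Theorem corollary1 (R : realType) (H : completeNormedModType R)
  (ip : {dot H for idfun}) (hH : norm_induced_by ip)
  (F Ft : H -> \bar R)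
  (hFproper : proper_functional F) (hFlsc : lower_semicontinuous F)
  (hFt : forall x, Ft x != -oo%E)
  (r M delta mu : R) (hr : 0 < r) (hM : 0 < M) (hdelta : 0 <= delta)
  (hgauge : (epi_gauge r M F Ft <= delta%:E)%E)
  (hmu : 0 < mu) (hgrowth : quadratic_growth F (origin_ball r) mu)
  (xs xt : H)
  (hxs : (argmin setT F `&` origin_ball r) xs)
  (hxt : argmin (origin_ball r) Ft xt)
  (hFxs : ((- M)%:E <= F xs <= M%:E)%E)
  (hFtxs : ((- M)%:E <= Ft xs <= M%:E)%E)
  (hFxt : ((- M)%:E <= F xt <= M%:E)%E)
  (hFtxt : ((- M)%:E <= Ft xt <= M%:E)%E) :
  dist xt (argmin setT F) <= 2 * Num.sqrt (delta / mu).
Proof.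
case: hxs => xsmin xsr; case: hxt => xtr xtmin.
have fin (y : \bar R) : ((- M)%:E <= y <= M%:E)%E ->
    exists2 a, y = a%:E & - M <= a.
  by case: y => [a||] //=; rewrite ?leye_eq ?leeNy_eq ?andbF // !lee_fin
    => /andP[? _]; exists a.
have [a Fxs Ma] := fin _ hFxs; have [b Ftxs Mb] := fin _ hFtxs.
have [c Fxt Mc] := fin _ hFxt; have [e Ftxt Me] := fin _ hFtxt.
have ab := epi_gauge_value_close (ltW hM) hgauge xsr Fxs Ftxs Ma Mb.
have ce := epi_gauge_value_close (ltW hM) hgauge xtr Fxt Ftxt Mc Me.
have eb : e <= b by have := xtmin _ xsr; rewrite Ftxt Ftxs lee_fin.
have := hgrowth _ xtr; rewrite (ereal_inf_range_argmin xsmin) Fxt Fxs.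
rewrite -EFinB lee_fin; set d := dist _ _ => growth.
have gap : c - a <= 2 * delta.
  by move: ab ce; rewrite !ler_norml => /andP[? ?] /andP[? ?]; lra.
have dsq : d ^+ 2 <= 2 ^+ 2 * (delta / mu).
  by rewrite mulrA ler_pdivlMr //; lra.
apply: le_trans (ler_norm d) _.
rewrite -sqrtr_sqr -[X in X * _](@ger0_norm R 2) // -sqrtr_sqr -sqrtrM ?sqr_ge0 //.
exact: ler_wsqrtr.
Qed.
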